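(* Let $(\mathcal P,\le_{\mathcal P})$ be a finite poset, let $I\subseteq\mathcal P$ be an order ideal, and let $\mu,\nu$ be probability measures on $\mathcal P$. Assume that $\mu\preceq_{HS}\nu$ on $\mathcal P$ and $$\mu[z]=\nu[z],\qquad z\in\mathcal P\setminus I.$$ Then $\mu_{\mid I}\preceq_{HS}\nu_{\mid I}$ on $\mathcal P_{\mid I}$. In particular, if $\mu[I]=\nu[I]>0$, then $\mu^{I}\preceq_{HS}\nu^{I}$ on $\mathcal P_{\mid I}$.
   Context: For a finite poset $(\mathcal P,\le)$ and $x,z\in\mathcal P$, the hockey-stick function is $\Phi_x^{\mathcal P}(z):=\sum_{y\in\mathcal P}\mathbb 1_{\{x\le y\le z\}}$. For a signed measure $\rho$ on $\mathcal P$ and $f:\mathcal P\to\mathbb R$, $\langle\rho,f\rangle:=\int_{\mathcal P}f(x)\,\rho(dx)$. For signed measures $\mu,\nu$ on $\mathcal P$, $\mu\preceq_{HS}\nu$ on $\mathcal P$ means that $\langle\nu-\mu,\Phi_x^{\mathcal P}\rangle\ge0$ for every $x\in\mathcal P$. $\mu[z]$ denotes the mass of the singleton $\{z\}$ and $\mu[I]$ the mass of $I$. A subset $I\subseteq\mathcal P$ is an order ideal if $z\in I$ and $y\le_{\mathcal P}z$ imply $y\in I$. $\mathcal P_{\mid I}$ is the induced subposet on $I$. The restriction of $\mu$ is $\mu_{\mid I}[z]:=\mu[z]\mathbb 1_{\{z\in I\}}$, regarded as a measure on $I$. If $\mu[I]>0$, the conditional restriction is $\mu^I[z]:=\frac{\mu[z]}{\mu[I]}\mathbb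 1_{\{z\in I\}}$, a probability measure on $I$. *)

(* Defs.v *)
From HB Require Import structures.
From mathcomp Require Import all_boot all_order all_algebra.

Set Implicit Arguments.
Unset Strict Implicit.
Unset Printing Implicit Defensive.

Import Order.TTheory GRing.Theory Num.Theory.
Local Open Scope ring_scope.

(* The order [x <= y] on [induced I] is [val x <= val y] in [P]. *)
Section InducedSubposet.
Context {d : Order.disp_t} {P : finPOrderType d}.

Definition induced (I : {set P}) : Type := {x : P | x \in I}.

HB.instance Definition _ (I : {set P}) := Finite.on (induced I).
HB.instance Definition _ (I : {set P}) := SubType.on (induced I).
HB.instance Definition _ (I : {set P}) :=
  [SubChoice_isSubPOrder of induced I by <: with d].

Definition order_ideal (I : {set P}) : Prop :=
  forall y z : P, z \in I -> (y <= z)%O -> y \in I.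

End InducedSubposet.

(* On a finite set every subset is measurable, so a finite signed measure is
   encoded by its masses on singletons, as an element of {ffun T -> R}; the sum
   and difference of measures are those of {ffun T -> R}. *)
Section Measures.
Context {R : realFieldType} {T : finType}.
Implicit Types (rho mu : {ffun T -> R}) (A : {set T}).

Definition mass rho A : R := \sum_(z in A) rho z.

Definition is_probability mu : Prop :=
  (forall z : T, 0 <= mu z) /\ mass mu [set: T] = 1.

Definition pairing rho (f : T -> R) : R := \sum_(x : T) f x * rho x.

End Measures.

Section HockeyStick.
Context {R : realFieldType} {d : Order.disp_t} {P : finPOrderType d}.

Definition hockey_stick (x z : P) : R :=
  \sum_(y : P) ((x <= y)%O && (y <= z)%O)%:R.

Definition HS_le (mu nu : {ffun P -> R}) : Prop :=
  forall x : P, 0 <= pairing (nu - mu) (hockey_stick x).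

End HockeyStick.

Section Restriction.
Context {R : realFieldType} {d : Order.disp_t} {P : finPOrderType d}.
Implicit Types (rho mu : {ffun P -> R}) (I : {set P}).

(* A measure on [P] carried by [I], regarded as a measure on [I]. *)
Definition as_measure_on I rho : {ffun induced I -> R} :=
  [ffun z : induced I => rho (val z)].

Definition restriction mu I : {ffun induced I -> R} :=
  as_measure_on I [ffun z : P => mu z * (z \in I)%:R].

(* Only meaningful when [mass mu I > 0]; otherwise [_ / 0 = 0]. *)
Definition conditional_restriction mu I : {ffun induced I -> R} :=
  as_measure_on I [ffun z : P => mu z / mass mu I * (z \in I)%:R].

End Restriction.

(* Main.v *)
(* If z lies in an order ideal I, the interval [x, z] is contained in I, so the
   hockey-stick functions of the induced poset are those of P; the points outside
   I contribute nothing to the pairing because mu and nu agree there. *)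
Require Import Defs.
From mathcomp Require Import all_boot all_order all_algebra.
Import Order.TTheory GRing.Theory Num.Theory.
Local Open Scope ring_scope.

Section RestrictionToIdeal.
Context {R : realFieldType} {d : Order.disp_t} {P : finPOrderType d}.
Implicit Types (I : {set P}) (mu nu : {ffun P -> R}).

Lemma sum_induced I (F : P -> R) :
  \sum_(z : induced I) F (val z) = \sum_(z in I) F z.
Proof. exact/esym/big_sub. Qed.

Lemma hockey_stick_induced I (x z : induced I) :
  order_ideal I -> hockey_stick x z = hockey_stick (val x) (val z) :> R.
Proof.
move=> hI; rewrite /hockey_stick.
rewrite (sum_induced I (fun y => ((val x <= y)%O && (y <= val z)%O)%:R)).
(* A point [y] outside [I] cannot lie below [val z], since [I] is closed downwards; its indicator is
   0. *)
rewrite [RHS](bigID (mem I)) /= [X in _ + X]big1 ?addr0 // => y yNI.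
case: (boolP (y <= val z)%O) => [yz|_]; last by rewrite andbF.
by rewrite (hI _ _ (valP z) yz) in yNI.
Qed.

Lemma restrictionE mu I (z : induced I) : restriction mu I z = mu (val z).
Proof. by rewrite !ffunE (valP z) mulr1. Qed.

(** Exhibits conditioning as a scaling by a constant, so that the second claim can be reduced to the
    first. *)
Lemma conditional_restrictionE mu I (z : induced I) :
  conditional_restriction mu I z = (mass mu I)^-1 * restriction mu I z.
Proof. by rewrite restrictionE !ffunE (valP z) mulr1 mulrC. Qed.

(** Being an equality, this carries the sign of the pairing at [val x] over to [x]. *)
Lemma pairing_restrictionB mu nu I (x : induced I) :
  order_ideal I -> (forall z, z \notin I -> mu z = nu z) ->
  pairing (restriction nu I - restriction mu I) (hockey_stick x)
  = pairing (nu - mu) (hockey_stick (val x)).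
Proof.
move=> hI hout; rewrite /pairing [RHS](bigID (mem I)) /=.
rewrite [X in _ = _ + X]big1 ?addr0; last first.
  by move=> z zNI; rewrite !ffunE hout // subrr mulr0.
rewrite -(sum_induced I (fun z => hockey_stick (val x) z * (nu - mu) z)).
apply: eq_bigr => z _; rewrite hockey_stick_induced //; congr (_ * _).
by rewrite !ffunE (valP z) !mulr1.
Qed.

End RestrictionToIdeal.

Theorem proposition5p5 (R : realFieldType) (d : Order.disp_t)
    (P : finPOrderType d) (I : {set P}) (mu nu : {ffun P -> R})
    (hI : order_ideal I)
    (hmu : is_probability mu) (hnu : is_probability nu)
    (hHS : HS_le mu nu)
    (hout : forall z : P, z \notin I -> mu z = nu z) :
  HS_le (restriction mu I) (restriction nu I) /\
  (mass mu I = mass nu I -> 0 < mass nu I ->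
     HS_le (conditional_restriction mu I) (conditional_restriction nu I)).
Proof.
have hres : HS_le (restriction mu I) (restriction nu I).
  by move=> x; rewrite pairing_restrictionB.
split=> // mass_eq mass_gt0 x.
(* Equal masses give both measures the same normalising factor, so it comes out of the difference;
   it is nonnegative and keeps the sign. *)
suff -> : pairing (conditional_restriction nu I - conditional_restriction mu I)
            (hockey_stick x)
          = (mass nu I)^-1 *
            pairing (restriction nu I - restriction mu I) (hockey_stick x).
  by apply: mulr_ge0 (hres x); rewrite invr_ge0 ltW.
rewrite /pairing mulr_sumr; apply: eq_bigr => z _.
rewrite mulrCA; congr (_ * _).
(* Rewriting with [ffunE] directly would also unfold the restrictions; [subE] leaves them folded for
   [conditional_restrictionE]. *)
have subE (f g : {ffun induced I -> R}) : (f - g) z = f z - g z by rewrite !ffunE.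
by rewrite !subE !conditional_restrictionE mass_eq mulrBr.
Qed.
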